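(* Let the logical computational-basis output bit be $y$, and let the final $X$ mask from the persistent matching-hidden split quantum one-time-pad frame (described in the context), after applying the hidden common-node matching for the measured register, be split as $$x=x^{(1)}\oplus x^{(2)}\oplus x^{(R)}.$$ Here $x^{(2)}$ denotes the second share aligned to the measured output by the common-node matching, and $x^{(R)}$ denotes the hidden common-node refresh share in the recommended high-security variant. If the measuring party obtains $$m=y\oplus x^{(1)}\oplus x^{(2)}\oplus x^{(R)},$$ then the client recovers $$y=m\oplus x^{(1)}\oplus x^{(2)}\oplus x^{(R)}.$$ Against any allowed coalition whose view does not determine the aligned final $X$ key, the output bit $y$ is information-theoretically hidden, provided the missing aligned key information is uniform and secret.
   Context: Setting: a classical client delegates a quantum computation to two computational servers $S_1,S_2$ and a common routing node $R$. The client generates all classical key shares. The allowed coalitions are the proper subsets $C\subsetneq\{S_1,S_2,R\}$; the full coalition is excluded. Parties are purified semi-honest: they follow the prescribed operations, but may keep all purifying systems, auxiliary registers, measurement outcomes, randomness and classical side information compatible with an honest implementation, and members of a coalition may pool what they hold. The view of a coalition is all classical and quantum information so retained. Split quantum one-time pad: each server-visible qubit register is encrypted by a Pauli mask $X^xZ^z$ with $x,z\in\{0,1\}$. For a batch of $m_0$ registers, $S_1$ has a table of key shares $(x_i^{(1)},z_i^{(1)})$, $S_2$ has a table of key shares $(x_j^{(2)},z_j^{(2)})$, and $R$ stores a matching permutation $\sigma_R$ of $\{1,\dots,m_0\}$, hidden from the computational servers and from any allowed coalition not containing $R$. In the recommended high-security variant $R$ also holds a hidden table of refresh shares $(x_i^{(R)},z_i^{(R)})$.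 The aligned key of register $i$ is $x_i=x_i^{(1)}\oplus x_{\sigma_R(i)}^{(2)}\oplus x_i^{(R)}$, $z_i=z_i^{(1)}\oplus z_{\sigma_R(i)}^{(2)}\oplus z_i^{(R)}$. This encryption is maintained throughout the computation (''persistent''), with key shares updated as gates are applied; the ''final $X$ mask'' or ''aligned final $X$ key'' is the $X$ component of the aligned key of the measured register at the time of measurement. Measuring a qubit encrypted by $X^xZ^z$ in the computational basis gives the logical outcome XORed with $x$; the $Z$ component does not change computational-basis outcomes.
   Formalization: The hiding claim additionally assumes that what the coalition retains besides the measured bit m does not by itself depend on the output y; otherwise, e.g., a noisy copy of y in another register would reveal it partially. *)

(* Defs.v *)
From HB Require Import structures.
From mathcomp Require Import all_boot all_order all_algebra all_fingroup.

Set Implicit Arguments.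
Unset Strict Implicit.
Unset Printing Implicit Defensive.

Import GRing.Theory Num.Theory.
Local Open Scope ring_scope.

Inductive party := S1 | S2 | Router.

Definition party_code (p : party) : 'I_3 :=
  match p with S1 => inord 0 | S2 => inord 1 | Router => inord 2 end.
Definition party_decode (i : 'I_3) : party :=
  match val i with 0%N => S1 | 1%N => S2 | _ => Router end.
Lemma party_codeK : cancel party_code party_decode.
Proof. by case; rewrite /party_decode /= inordK. Qed.
HB.instance Definition _ := Finite.copy party (can_type party_codeK).

Definition allowed (C : {set party}) : bool := C \proper [set: party].

(** ** Split key material *)

(* A table lists one share (x, z) of the Pauli exponents per register. *)
Definition table (m0 : nat) := {ffun 'I_m0 -> bool * bool}.

(* Key material (k1, k2, (s, kR)) at the time of the measurement, i.e. after
   all key updates: the table of S1, the table of S2, and the matching together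
   with the refresh table of the routing node.  Without the refresh variant,
   kR is the all-zero table. *)
Definition keys (m0 : nat) : finType :=
  (table m0 * table m0 * ('S_m0 * table m0))%type.

Section Shares.
Variable m0 : nat.
Implicit Types (k : keys m0) (i : 'I_m0) (C : {set party}).

Definition table1 k : table m0 := k.1.1.
Definition table2 k : table m0 := k.1.2.
Definition matching k : 'S_m0 := k.2.1.
Definition refresh k : table m0 := k.2.2.

Definition x1 k i : bool := (table1 k i).1.
Definition x2 k i : bool := (table2 k (matching k i)).1.
Definition xR k i : bool := (refresh k i).1.
Definition z1 k i : bool := (table1 k i).2.
Definition z2 k i : bool := (table2 k (matching k i)).2.
Definition zR k i : bool := (refresh k i).2.

Definition aligned_x k i : bool := x1 k i (+) x2 k i (+) xR k i.
Definition aligned_z k i : bool := z1 k i (+) z2 k i (+) zR k i.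

Definition holdings_type : finType :=
  (option (table m0) * option (table m0) * option ('S_m0 * table m0))%type.

Definition holdings C k : holdings_type :=
  (if S1 \in C then Some (table1 k) else None,
   if S2 \in C then Some (table2 k) else None,
   if Router \in C then Some (matching k, refresh k) else None).

End Shares.

(** ** The encrypted output qubit *)

Section Qubit.
Variable K : numClosedFieldType.

Definition pauliX : 'M[K]_2 := \matrix_(i, j) (i != j)%:R.
Definition pauliZ : 'M[K]_2 := \matrix_(i, j) ((-1) ^+ i * (i == j)%:R).
Definition mask (x z : bool) : 'M[K]_2 := pauliX ^+ x * pauliZ ^+ z.

Definition ket (b : bool) : 'cV[K]_2 := delta_mx (inord b) 0.

(* Born rule for the computational-basis measurement. *)
Definition born (psi : 'cV[K]_2) (m : bool) : K := `|psi (inord m) 0| ^+ 2.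

(* Probability of the recorded bit m when the logical output bit is y and the
   measured register i is encrypted with the aligned key of k.  Given the
   logical outcome y, the register may be taken in the logical state |y>, since
   Pauli masks permute the computational-basis projectors. *)
Definition outcome_law (m0 : nat) (i : 'I_m0) (k : keys m0) (y m : bool) : K :=
  born (mask (aligned_x k i) (aligned_z k i) *m ket y) m.

Definition fair_coin (m0 : nat) (k : keys m0) (y m : bool) : K := 2^-1.

End Qubit.

(** ** Classical-quantum states and views *)

Section Views.
Variables (K : numClosedFieldType) (m0 : nat) (T : finType) (d : nat).

Definition psd (A : 'M[K]_d) : Prop :=
  forall v : 'cV[K]_d, 0 <= ((map_mx Num.conj v)^T *m A *m v) 0 0.

(* State of the key material and of what a coalition retains besides its own
   shares and the recorded bit: omega k t is the unnormalized density operator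
   on the retained d-dimensional quantum system, jointly with the event that
   the key material is k and the retained classical data is t. *)
Definition cq_family := keys m0 -> T -> 'M[K]_d.

Definition cq_state (omega : cq_family) : Prop :=
  (forall k t, psd (omega k t)) /\ \sum_k \sum_t \tr (omega k t) = 1.

(* The family omega below is indexed by the logical output bit y: no prior on
   y is fixed. *)
Variables (C : {set party}) (i : 'I_m0) (omega : bool -> cq_family).

Definition side_info (y : bool) (h : holdings_type m0) (t : T) : 'M[K]_d :=
  \sum_(k | holdings C k == h) omega y k t.

Definition side_info_at_key (b y : bool) (h : holdings_type m0) (t : T)
    : 'M[K]_d :=
  \sum_(k | (holdings C k == h) && (aligned_x k i == b)) omega y k t.

(* Whatever y is, the aligned final X key is uniform and in product form with
   everything the coalition retains besides the recorded bit. *)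
Definition uniform_and_secret : Prop :=
  forall b y h t, side_info_at_key b y h t = 2^-1 *: side_info y h t.

(* Whatever is retained besides the recorded bit is still encrypted, so that
   it does not by itself depend on the logical output. *)
Definition persistently_encrypted : Prop :=
  forall h t, side_info false h t = side_info true h t.

(* L is the set of parties that get to know the recorded bit: the measuring
   party, and possibly others (e.g. a node relaying it to the client). *)
Variable L : {set party}.

Definition observed (m : bool) : option bool :=
  if [disjoint C & L] then None else Some m.

Definition view_type : finType := (option bool * holdings_type m0 * T)%type.

Section Law.
Variable law : keys m0 -> bool -> bool -> K.

(* Unnormalized state of the coalition's full view, jointly with the event
   that the aligned final X key is b; the recorded bit follows law. *)
Definition view_at_key (b y : bool) (v : view_type) : 'M[K]_d :=
  \sum_(k | (holdings C k == v.1.2) && (aligned_x k i == b))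
    \sum_(m | observed m == v.1.1) law k y m *: omega y k v.2.

Definition view_with (y : bool) (v : view_type) : 'M[K]_d :=
  \sum_b view_at_key b y v.
End Law.

Definition view : bool -> view_type -> 'M[K]_d :=
  view_with (@outcome_law K m0 i).

(* The view in which the recorded bit is replaced by an independent coin. *)
Definition view_with_coin : bool -> view_type -> 'M[K]_d :=
  view_with (@fair_coin K m0).

(* Some measurement (POVM) of the full view outputs the aligned final X key
   with certainty, whatever the logical output bit is. *)
Definition determines_key : Prop :=
  exists F : view_type -> bool -> 'M[K]_d,
    [/\ forall v b, psd (F v b),
        forall v, \sum_b F v b = 1%:M
      & forall y, \sum_b \sum_v
          \tr (F v b *m view_at_key (@outcome_law K m0 i) b y v) = 1].

(* Perfect secrecy: the states of the view for the two output bits coincide. *)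
Definition output_hidden : Prop := view false =1 view true.

End Views.

(* Main.v *)
(** Whatever the bit [y], the uniform aligned key [b] makes [y (+) b] a fair
    coin.  As the key is in product form with everything else that is retained,
    the recorded bit can then be replaced by an independent coin, and the view
    is a multiple of the side information. *)
Require Import Defs.
From mathcomp Require Import all_boot all_order all_algebra all_fingroup.

Set Implicit Arguments.
Unset Strict Implicit.
Unset Printing Implicit Defensive.

Import GRing.Theory Num.Theory.
Local Open Scope ring_scope.

Section PauliOnKet.
Variable K : numClosedFieldType.

Lemma inord_bool_inj : injective (fun b : bool => inord b : 'I_2).
Proof. by move=> [] [] // /(congr1 val) /=; rewrite !inordK. Qed.

Lemma big_bool_inord (F : 'I_2 -> K) :
  \sum_j F j = F (inord false) + F (inord true).
Proof.
rewrite big_ord_recl big_ord1; congr (F _ + F _);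
  by apply: val_inj; rewrite /= inordK.
Qed.

Lemma ketE (y b : bool) : ket K y (inord b) 0 = (b == y)%:R.
Proof. by rewrite mxE eqxx andbT (inj_eq inord_bool_inj). Qed.

(** [inord false] and [inord true] exhaust ['I_2], so equalities between kets reduce to a check on
    booleans. *)
Lemma ket_ext (u v : 'cV[K]_2) :
  (forall b : bool, u (inord b) 0 = v (inord b) 0) -> u = v.
Proof.
move=> uv; apply/matrixP=> j l; rewrite ord1.
have lt_j1 : (j <= 1)%N by rewrite -ltnS.
have -> : j = inord (j == 1%N :> nat).
  by apply: val_inj; rewrite /= inordK; case: (val j) lt_j1 => [|[]].
exact: uv.
Qed.

Lemma pauliX_ket (y : bool) : pauliX K *m ket K y = ket K (~~ y).
Proof.
apply: ket_ext => b; rewrite !mxE big_bool_inord !ketE !mxE.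
rewrite !(inj_eq inord_bool_inj) eqxx andbT.
by case: b y => [] []; rewrite /= ?(mulr0, mulr1, addr0, add0r).
Qed.

Lemma pauliZ_ket (y : bool) : pauliZ K *m ket K y = (-1) ^+ y *: ket K y.
Proof.
apply: ket_ext => b; rewrite !mxE big_bool_inord !ketE !mxE.
rewrite !(inj_eq inord_bool_inj) eqxx andbT.
by case: b y => [] []; rewrite !inordK //= ?(mulr0, mulr1, addr0, add0r).
Qed.

(** The [Z] factor acts first and has [ket K y] as an eigenvector, so it leaves only a sign; the [X]
    factor then flips the bit. *)
Lemma mask_ket (x z y : bool) :
  Defs.mask K x z *m ket K y = (-1) ^+ (z && y) *: ket K (y (+) x).
Proof.
rewrite /Defs.mask -mulmxE -mulmxA.
have -> : pauliZ K ^+ z *m ket K y = (-1) ^+ (z && y) *: ket K y.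
  by case: z; rewrite ?expr1 ?pauliZ_ket // expr0 mul1mx expr0 scale1r.
rewrite -scalemxAr; congr (_ *: _).
by case: x; rewrite ?expr1 ?pauliX_ket ?addbT // expr0 mul1mx addbF.
Qed.

(** The modulus in the Born rule erases the sign left by [Z], so the outcome is deterministic and
    sees only the [X] key. *)
Lemma outcome_lawE (m0 : nat) (i : 'I_m0) (k : keys m0) (y m : bool) :
  outcome_law K i k y m = (m == y (+) aligned_x k i)%:R.
Proof.
rewrite /outcome_law /born mask_ket mxE ketE normrM normr_sign mul1r.
by rewrite normr_nat; case: eqP; rewrite ?expr1n ?expr0n.
Qed.

End PauliOnKet.

Section UniformKey.
Variables (K : numClosedFieldType) (m0 : nat) (T : finType) (d : nat).
Variables (C L : {set party}) (i : 'I_m0) (omega : bool -> cq_family K m0 T d).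
Hypothesis unif : uniform_and_secret C i omega.

(** On the keys with aligned value [b] the law is constant and factors out of the sum. What remains
    is [side_info_at_key], which [unif] turns into half of [side_info]. *)
Lemma view_with_uniform (law : keys m0 -> bool -> bool -> K)
    (f : bool -> bool -> bool -> K) (y : bool) (v : view_type m0 T) :
  (forall k y m, law k y m = f (aligned_x k i) y m) ->
  view_with C i omega L law y v =
    (\sum_(m | observed C L m == v.1.1) \sum_b f b y m) *:
      (2^-1 *: side_info C omega y v.1.2 v.2).
Proof.
(* The swap on the right makes [b] the outer index, as in [view_with]. *)
move=> lawE; rewrite exchange_big scaler_suml; apply: eq_bigr => b _.
rewrite -(unif b) scaler_sumr; apply: eq_bigr => k /andP[_ /eqP kb].
by rewrite scaler_suml; apply: eq_bigr => m _; rewrite lawE kb.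
Qed.

(** For given [y] and [m], exactly one key value [b] satisfies [m = y (+) b], so each inner sum is
    1. The coefficient counts the recorded bits compatible with the observation. *)
Lemma view_uniform (y : bool) (v : view_type m0 T) :
  view C i omega L y v =
    (\sum_(m | observed C L m == v.1.1) 1) *:
      (2^-1 *: side_info C omega y v.1.2 v.2).
Proof.
rewrite /view (view_with_uniform (f := fun b y m => (m == y (+) b)%:R));
  last exact: outcome_lawE.
congr (_ *: _); apply: eq_bigr => m _; rewrite big_bool.
by case: m y => [] []; rewrite /= ?addr0 ?add0r.
Qed.

(** Here the inner sum is two halves, giving the same coefficient as for the true outcome law. *)
Lemma view_with_coin_uniform (y : bool) (v : view_type m0 T) :
  view_with_coin C i omega L y v =
    (\sum_(m | observed C L m == v.1.1) 1) *:
      (2^-1 *: side_info C omega y v.1.2 v.2).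
Proof.
rewrite /view_with_coin (view_with_uniform (f := fun _ _ _ => 2^-1)) //.
congr (_ *: _); apply: eq_bigr => m _.
by rewrite big_bool /= -mulr2n -[LHS]mulr_natr mulVf ?pnatr_eq0.
Qed.

End UniformKey.

Theorem proposition5p3
    (K : numClosedFieldType) (m0 : nat) (i : 'I_m0) :
  (forall (k : keys m0) (y m : bool),
     m = y (+) x1 k i (+) x2 k i (+) xR k i ->
     y = m (+) x1 k i (+) x2 k i (+) xR k i)
  /\
  (forall (C L : {set party}) (T : finType) (d : nat)
          (omega : bool -> cq_family K m0 T d),
     allowed C ->
     L != set0 ->
     (forall y, cq_state (omega y)) ->
     ~ determines_key C i omega L ->
     uniform_and_secret C i omega ->
     view C i omega L =2 view_with_coin C i omega L /\
     (persistently_encrypted C omega -> output_hidden C i omega L)).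
Proof.
split=> [k y m -> | C L T d omega _ _ _ _ unif].
  by case: y; case: (x1 k i); case: (x2 k i); case: (xR k i).
split=> [y v | enc v]; first by rewrite view_uniform ?view_with_coin_uniform.
(* The coefficient is free of [y]; only [side_info] could depend on it, and [enc] excludes this. *)
by rewrite !view_uniform // enc.
Qed.
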